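(* Let $\eta\in\{0,1\}^{\mathbb{N}^*}$ be a Sturmian sequence, let $u\in\{-1,0,1\}^{\mathbb{N}^*}$ be a generic point for some Bernoulli measure $\mathbb{B}$ on $\{-1,0,1\}^{\mathbb{N}^*}$, and let $z:=\eta\cdot u$. Then for every $\varepsilon>0$ there exists a Toeplitz sequence $t=(t_n)_{n\in\mathbb{N}^*}\in\{-1,0,1\}^{\mathbb{N}^*}$ which correlates with $z$, i.e. $$\liminf_{N\to\infty}\frac1N\sum_{n\le N}t_n\,z(n)>0,$$ and such that $$h_{top}(t)\ge(1-\varepsilon)\,h_{top}(z).$$
   Context: $\mathbb{N}^*=\{1,2,3,\dots\}$; sums $\sum_{n\le N}$ are over $1\le n\le N$; logarithms are to base $2$. The product of sequences is coordinatewise: $(\eta\cdot u)(n)=\eta(n)u(n)$. A block is a finite word over the alphabet; $p_n(w)$ is the number of distinct blocks of length $n$ appearing in $w$, and $h_{top}(w):=\lim_{n\to\infty}\frac1n\log p_n(w)$. A sequence $w\in\{0,1\}^{\mathbb{N}^*}$ is Sturmian if $p_n(w)=n+1$ for all $n\in\mathbb{N}^*$. A Bernoulli measure on $\{-1,0,1\}^{\mathbb{N}^*}$ is a product measure whose marginals are all equal to one probability distribution on $\{-1,0,1\}$. A point $u$ is generic for $\mathbb{B}$ if $\frac1N\sum_{n\le N}\delta_{S^nu}\to\mathbb{B}$ weakly as $N\to\infty$, where $S$ is the left shift, $(Sw)(n)=w(n+1)$. A sequence $t\in A^{\mathbb{N}^*}$ ($A$ a finite set) is Toeplitz if for each $a\in\mathbb{N}^*$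 there exists $r_a\in\mathbb{N}^*$ such that $t(a)=t(a+kr_a)$ for every $k\in\mathbb{N}^*$.
   Formalization: The Bernoulli measure is assumed not to be the point mass at the zero sequence; for that measure u = 0 is generic, z = 0, and no t correlates with z, so the claim is false there. *)

(* Defs.v *)
(* Conventions.
   - A sequence (w(n))_{n >= 1} is encoded as [w : nat -> A], the Rocq index n
     standing for the mathematical index n.+1: [\sum_(i < N) f (w i)] is the sum
     over 1 <= n <= N, and the left shift is [w \o succn].
   - 0/1-sequences are functions [nat -> bool]. *)
From HB Require Import structures.
From mathcomp Require Import all_boot all_order all_algebra.
From mathcomp Require Import all_classical all_reals all_analysis.
Import Order.TTheory GRing.Theory Num.Theory.
Import numFieldNormedType.Exports.
Set Implicit Arguments.
Unset Strict Implicit.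
Unset Printing Implicit Defensive.
Local Open Scope classical_set_scope.
Local Open Scope ring_scope.

Inductive sgn3 : Type := Neg1 | Zero | Pos1.

Definition sgn3_val (s : sgn3) : int :=
  match s with Neg1 => -1 | Zero => 0 | Pos1 => 1 end.

Definition sgn3_code (s : sgn3) : option bool :=
  match s with Neg1 => Some false | Zero => None | Pos1 => Some true end.

Definition sgn3_decode (o : option bool) : sgn3 :=
  match o with Some false => Neg1 | None => Zero | Some true => Pos1 end.

Lemma sgn3_codeK : cancel sgn3_code sgn3_decode.
Proof. by case. Qed.

HB.instance Definition _ := Finite.copy sgn3 (can_type sgn3_codeK).
HB.instance Definition _ := isPointed.Build sgn3 Zero.
HB.instance Definition _ := hasNbhs.Build sgn3 principal_filter.
HB.instance Definition _ := Discrete_ofNbhs.Build sgn3 erefl.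
HB.instance Definition _ := DiscreteUniform_ofNbhs.Build sgn3.
HB.instance Definition _ := @isMeasurable.Build default_measure_display
  sgn3 discrete_measurable discrete_measurable0
  discrete_measurableC discrete_measurableU.

Notation seq3 := {ptws nat -> sgn3}.
Notation borel_seq3 := (g_sigma_algebraType (@open seq3)).

Definition seq_mul (eta : nat -> bool) (u : nat -> sgn3) : nat -> sgn3 :=
  fun n => if eta n then u n else Zero.

Lemma seq_mul_val (eta : nat -> bool) (u : nat -> sgn3) (n : nat) :
  sgn3_val (seq_mul eta u n) = (eta n)%:R * sgn3_val (u n).
Proof. by rewrite /seq_mul; case: (eta n); rewrite ?mul1r ?mul0r. Qed.

Definition seq_shift (A : Type) (w : nat -> A) : nat -> A := w \o succn.

Definition block_count (A : finType) (w : nat -> A) (n : nat) : nat :=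
  #|[pred b : n.-tuple A |
      `[< exists i : nat, forall j : 'I_n, tnth b j = w (i + j)%N >]]|.

Definition log2 (R : realType) (x : R) : R := ln x / ln 2.

(* [limn] is a genuine limit here: log2 (block_count w n) is subadditive in n and
   nonnegative. *)
Definition htop (R : realType) (A : finType) (w : nat -> A) : R :=
  limn (fun n : nat => log2 ((block_count w n)%:R : R) / n%:R).

Definition sturmian (w : nat -> bool) : Prop :=
  forall n : nat, (0 < n)%N -> block_count w n = n.+1.

Definition toeplitz (A : Type) (t : nat -> A) : Prop :=
  forall a : nat, exists r : nat, (0 < r)%N /\
    forall k : nat, (0 < k)%N -> t a = t (a + k * r)%N.

Definition correlates (R : realType) (t z : nat -> sgn3) : Prop :=
  (0 < limn_einf (fun N : nat =>
    ((\sum_(n < N) (sgn3_val (t n))%:~R * (sgn3_val (z n))%:~R) / N%:R : R)%:E))%E.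

(* The finite-dimensional rectangles form a generating pi-system, so they
   determine the product measure. *)
Definition bernoulli (R : realType) (B : probability borel_seq3 R) : Prop :=
  exists P : probability sgn3 R, forall (n : nat) (A : 'I_n -> set sgn3),
    B [set w : nat -> sgn3 | forall i : 'I_n, A i (w i)] =
      (\prod_(i < n) P (A i))%E.

Definition weakly_cvg (R : realType)
    (mu_ : nat -> {measure set borel_seq3 -> \bar R})
    (mu : {measure set borel_seq3 -> \bar R}) : Prop :=
  forall f : seq3 -> R, continuous f -> bounded_fun f ->
    (fun N : nat => \int[mu_ N]_x (f x)%:E)%E @ \oo --> (\int[mu]_x (f x)%:E)%E.

(* The Dirac masses sit at S^1 u, ..., S^N u: here the exponent of the shift is
   n itself, hence the n.+1. *)
Definition empirical (R : realType) (u : nat -> sgn3) (N : nat)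
    : {measure set borel_seq3 -> \bar R} :=
  mscale (N%:R^-1)%:nng
    (msum (fun n : nat => \d_(iter n.+1 (@seq_shift sgn3) u : borel_seq3)) N).

Definition generic (R : realType) (u : nat -> sgn3)
    (B : {measure set borel_seq3 -> \bar R}) : Prop :=
  weakly_cvg (empirical R u) B.

(* Main.v *)
(* The sequence [t] is a Toeplitz sequence that agrees with [u] off a set of small
   density and nevertheless has entropy close to [log2 3], the largest possible
   value on three letters.  First plant, on a sparse set of windows, all words
   of length [window C k] at multiples of [period C D k], which changes [u] on a
   set of density at most [1/D].  Then make the result Toeplitz by copying, for
   every [k], its first [2 ^ k] letters with period [period C D k]; this again
   affects a sparse set, and it leaves most letters of every planted word alone.
   As [h_top z <= log2 3] trivially, only the correlation uses the hypotheses: it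
   is at least [c - 2/D], where [c] is the lower density of the [n] with
   [eta n = 1] and [u n <> 0].  To see [c > 0], note that ones have bounded gaps in
   [eta], so a block of [eta] of length [L = g m] has at least [m] ones; a window
   of [u] vanishes on all of them with frequency [p ^ m], where [p < 1] is the
   probability of the symbol 0.  There are only [L + 1] such blocks, and
   [(L + 1) p ^ m] tends to 0. *)
Require Import Defs.
From HB Require Import structures.
From mathcomp Require Import all_boot all_order all_algebra.
From mathcomp Require Import all_classical all_reals all_analysis.
From mathcomp Require Import zify ring lra.
Import Order.TTheory GRing.Theory Num.Theory.
Import numFieldNormedType.Exports.
Local Open Scope classical_set_scope.
Local Open Scope ring_scope.

(** * Toeplitz sequences of large entropy *)

Section Combinatorics.
Local Open Scope nat_scope.

Lemma sum_modn_lt (r l N : nat) : (0 < r)%N ->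
  (\sum_(x < N) (x %% r < l) <= (N %/ r).+1 * l)%N.
Proof.
move=> r0.
have lt_sum n : (\sum_(0 <= x < n) (x < l) <= l)%N.
  suff -> : (\sum_(0 <= x < n) (x < l) = minn n l)%N by rewrite geq_minr.
  elim: n => [|n IHn]; first by rewrite big_nil min0n.
  rewrite big_nat_recr //= IHn; lia.
have le_block m : (\sum_(0 <= x < m * r) (x %% r < l) <= m * l)%N.
  elim: m => [|m IHm]; first by rewrite mul0n big_nil.
  rewrite (big_cat_nat (n := m * r)) ?leq_mul //=.
  rewrite [X in _ <= X]mulSn [X in _ <= X]addnC leq_add //.
  rewrite -{1}[(m * r)%N]add0n big_addn mulSn addnK.
  rewrite (eq_big_nat _ _ (F2 := fun x => (x < l : nat))) //.
  by move=> x /andP[_ xr]; rewrite addnC modnMDl modn_small.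
apply: leq_trans (le_block _).
have leN : (N <= (N %/ r).+1 * r)%N by rewrite ltnW // ltn_ceil.
by rewrite (big_cat_nat (n := N)) //= big_mkord leq_addr.
Qed.

(** Skipping the first period cancels the rounding up in [sum_modn_lt]. Levels whose period exceeds
    [N] then contribute nothing, and the bound can be summed over all levels. *)
Lemma sum_ge_modn_lt (r l N : nat) : (0 < r)%N ->
  (\sum_(x < N) ((r <= x) && (x %% r < l)) <= N %/ r * l)%N.
Proof.
move=> r0; have [ltNr|lerN] := ltnP N r.
  rewrite big1 // => x _; have := ltn_ord x; lia.
rewrite -(big_mkord xpredT (fun x => ((r <= x) && (x %% r < l)) : nat)).
rewrite (big_cat_nat (n := r)) //= big_nat big1 ?add0n => [|x]; last by lia.
have -> : N %/ r = ((N - r) %/ r).+1.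
  by rewrite -{1}(subnK lerN) divnDr // divnn r0 addn1.
rewrite -{1}[r]add0n big_addn big_mkord; apply: leq_trans (sum_modn_lt _ _ _ r0).
by apply: leq_sum => x _; rewrite modnDr; case: (r <= _).
Qed.

(** The factor [C.+1] makes a copied prefix of length [2 ^ k] short compared with a planted word. *)
Definition window (C k : nat) : nat := C.+1 * 2 ^ k.

(* Growth by the factor [4 ^ window C k] makes room for the [3 ^ window C k] planted
   words below the next period. *)
Definition period (C D k : nat) : nat := D.+1 * 4 ^ window C k.

Lemma period_gt0 (C D k : nat) : 0 < period C D k.
Proof. by rewrite muln_gt0 expn_gt0. Qed.

Lemma dvdn_period (C D j k : nat) : j <= k -> period C D j %| period C D k.
Proof. by move=> lejk; rewrite dvdn_mul // dvdn_exp2l // leq_mul // leq_pexp2l. Qed.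

Lemma leq_period (C D j k : nat) : j <= k -> period C D j <= period C D k.
Proof. by move=> /(dvdn_period C D)/dvdn_leq -> //; apply: period_gt0. Qed.

Lemma periodS (C D k : nat) : period C D k.+1 = period C D k * 4 ^ window C k.
Proof. by rewrite /period -mulnA -expnD /window expnS mul2n -addnn mulnDr. Qed.

(** With [w = window C k], split [4 ^ w] as [2 ^ w * 2 ^ w]: one factor absorbs [w], the other
    [2 ^ k.+1], which makes the densities of the windows summable over [k]. *)
Lemma leq_window_period (C D k : nat) :
  D.+1 * 2 ^ k.+1 * window C k <= period C D k.
Proof.
have lt_kw : k.+1 <= window C k.
  by rewrite (leq_trans (ltn_expl k (ltnSn 1))) // leq_pmull.
rewrite /period -mulnA leq_mul // -[4]/(2 * 2) expnMn leq_mul //.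
  by rewrite leq_pexp2l.
by rewrite ltnW // ltn_expl.
Qed.

Lemma ltn_period (C D k : nat) : k < period C D k.
Proof.
apply: leq_trans (leq_window_period C D k).
apply: (leq_trans (ltn_expl k (ltnSn 1))).
rewrite -mulnA mulnC expnS /window; nia.
Qed.

Lemma sum_div_period (C D N K : nat) :
  D.+1 * \sum_(k < K) N %/ period C D k * window C k <= N.
Proof.
have term k : D.+1 * 2 ^ k.+1 * (N %/ period C D k * window C k) <= N.
  apply: leq_trans (leq_trunc_div N (period C D k)).
  by rewrite mulnCA leq_mul // leq_window_period.
(* This is the partial sum [1 - 2 ^ -K] of the geometric series, cleared of denominators; the extra
   [N] carries the induction. *)
suff : 2 ^ K * (D.+1 * \sum_(k < K) N %/ period C D k * window C k) + N <= 2 ^ K * N.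
  have : 0 < 2 ^ K by rewrite expn_gt0.
  by nia.
elim: K => [|K IHK]; first by rewrite big_ord0 !muln0 expn0 mul1n.
rewrite big_ord_recr /=; move: (term K) IHK; rewrite expnS.
move: (\sum_(k < K) _) (_ * window _ _) (2 ^ K) => x y z; nia.
Qed.

Lemma level_exists (C D n : nat) : exists k, n %% period C D k < 2 ^ k.
Proof. by exists n; apply: leq_ltn_trans (leq_mod _ _) (ltn_expl _ _). Qed.

Definition level (C D n : nat) : nat := ex_minn (level_exists C D n).

(* With the least such [k], [level] is unchanged along the progression of
   difference [period C D k], which makes the result Toeplitz. *)
Definition periodize (C D : nat) {T : Type} (v : nat -> T) (n : nat) : T :=
  v (n %% period C D (level C D n)).

Lemma toeplitz_periodize (C D : nat) (T : Type) (v : nat -> T) :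
  toeplitz (periodize C D v).
Proof.
move=> a; exists (period C D (level C D a)); split; first exact: period_gt0.
move=> k _; rewrite /periodize.
suff -> : level C D (a + k * period C D (level C D a)) = level C D a.
  by rewrite addnC modnMDl.
rewrite {1}/level; case: ex_minnP => m; rewrite /level.
case: ex_minnP => l ltl minl.
(* [period C D j] divides [period C D l], so the shift preserves every residue that decides the
   level. *)
have mod_eq j : j <= l -> a + k * period C D l = a %[mod period C D j].
  by move=> lejl; rewrite -modnDmr (eqP (dvdn_mull _ (dvdn_period C D j l lejl))) addn0.
move=> ltm minm; apply/eqP; rewrite eqn_leq minm ?mod_eq //=.
have [//|ltml] := leqP l m.
by move: (minl m); rewrite -mod_eq ?(ltnW ltml) // => /(_ ltm); rewrite leqNgt ltml.
Qed.

(** The residue condition forces the level to be at least [k], and [n] is its own residue modulo the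
    period of that level. *)
Lemma periodize_id (C D : nat) (T : Type) (v : nat -> T) (n k : nat) :
    n < period C D k ->
    (forall j, j < k -> 2 ^ j <= n %% period C D j) ->
  periodize C D v n = v n.
Proof.
move=> ltn hj; rewrite /periodize /level; case: ex_minnP => m ltm _.
have lekm : k <= m by rewrite leqNgt; apply: contraL ltm => /hj; rewrite -leqNgt.
by rewrite modn_small // (leq_trans ltn) // leq_period.
Qed.

Lemma periodize_neq (C D : nat) (T : Type) (v : nat -> T) (n : nat) :
    periodize C D v n <> v n ->
  exists k, period C D k <= n /\ n %% period C D k < 2 ^ k.
Proof.
rewrite /periodize /level; case: ex_minnP => m ltm _ neq.
exists m; split=> //; rewrite leqNgt; apply/negP => /modn_small eqn.
by rewrite eqn in neq.
Qed.

(** Beyond the [3 ^ L] words this is the empty list, so [planted] writes zeros at the multiples left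
    over. *)
Definition word (L j : nat) : seq sgn3 :=
  nth [::] [seq tval b | b <- enum {: L.-tuple sgn3}] j.

Lemma card_sgn3 : #|{: sgn3}| = 3.
Proof.
rewrite -card_bool -card_option; apply: bij_eq_card.
by exists sgn3_decode; [exact: sgn3_codeK | case=> [[]|]].
Qed.

Lemma word_surj (L : nat) (b : L.-tuple sgn3) :
  exists2 j, j < 3 ^ L & word L j = b.
Proof.
have ltj : index b (enum {: L.-tuple sgn3}) < size (enum {: L.-tuple sgn3}).
  by rewrite index_mem mem_enum.
exists (index b (enum {: L.-tuple sgn3})).
  by rewrite -card_sgn3 -card_tuple cardE.
by rewrite /word (nth_map b) // nth_index // mem_enum.
Qed.

Lemma stage_exists (C D n : nat) : exists k, n < period C D k.+1.
Proof. by exists n; apply: ltn_trans (ltn_period C D n.+1). Qed.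

(** Indices below [period C D 0] also get stage 0, hence the separate test [period C D k <= n] in
    [planted]. *)
Definition stage (C D n : nat) : nat := ex_minn (stage_exists C D n).

Lemma stageE (C D n k : nat) :
  period C D k <= n < period C D k.+1 -> stage C D n = k.
Proof.
move=> /andP[len ltn]; rewrite /stage; case: ex_minnP => m ltm /(_ k ltn) lemk.
apply/eqP; rewrite eqn_leq lemk leqNgt; apply/negP => ltmk.
by move: (leq_trans ltm (leq_period C D _ _ ltmk)); rewrite ltnNge len.
Qed.

(* Word number [j] sits at [j.+1 * period C D k]: the multiple 0 is skipped, so that
   every planted position is at least [period C D k]. *)
Definition planted (C D : nat) (u : nat -> sgn3) (n : nat) : sgn3 :=
  let k := stage C D n in
  if (period C D k <= n) && (n %% period C D k < window C k)
  then nth Zero (word (window C k) (n %/ period C D k).-1) (n %% period C D k)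
  else u n.

Lemma planted_word (C D : nat) (u : nat -> sgn3) (k i j : nat) :
    i < window C k -> j < 3 ^ window C k ->
  [/\ j.+1 * period C D k + i < period C D k.+1,
      (j.+1 * period C D k + i) %% period C D k = i &
      planted C D u (j.+1 * period C D k + i) = nth Zero (word (window C k) j) i].
Proof.
move=> lti ltj; have lt_ip : i < period C D k.
  apply: leq_trans lti (leq_trans _ (leq_window_period C D k)).
  by rewrite leq_pmull // muln_gt0 expn_gt0.
have ltn : j.+1 * period C D k + i < period C D k.+1.
  (* The word ends below the multiple [j.+2], and [j.+2 <= (3 ^ window C k).+1 <= 4 ^ window C
     k]. *)
  rewrite periodS; apply: (@leq_trans (j.+2 * period C D k)).
    by rewrite [X in _ < X]mulSnr ltn_add2l.
  rewrite mulnC leq_mul //; apply: (@leq_trans (3 ^ window C k).+1) => //.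
  have : 0 < window C k by rewrite muln_gt0 expn_gt0.
  by move=> w0; rewrite ltn_exp2r.
have mod_i : (j.+1 * period C D k + i) %% period C D k = i.
  by rewrite modnMDl modn_small.
split=> //; rewrite /planted (@stageE _ _ _ k); last by rewrite ltn mulSn -addnA leq_addr.
rewrite mod_i lti mulSn -addnA leq_addr /= addnA -mulSn divnMDl ?period_gt0 //.
by rewrite divn_small // addn0.
Qed.

Lemma planted_neq (C D : nat) (u : nat -> sgn3) (n : nat) :
    planted C D u n <> u n ->
  exists k, period C D k <= n /\ n %% period C D k < window C k.
Proof. by rewrite /planted; case: ifP => // /andP[]; exists (stage C D n). Qed.

(** Since [2 ^ k <= window C k], one sum over the levels bounds both the planted and the copied
    positions. *)
Lemma count_periodize_neq (C D : nat) (u : nat -> sgn3) (N : nat) :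
  D.+1 * \sum_(n < N) (periodize C D (planted C D u) n != u n) <= N.
Proof.
apply: leq_trans (sum_div_period C D N N); rewrite leq_mul //.
apply: (@leq_trans (\sum_(n < N) \sum_(k < N)
    ((period C D k <= n) && (n %% period C D k < window C k)))).
  apply: leq_sum => n _; have [//|neq] := eqVneq.
  have [k [lek ltk]] : exists k, period C D k <= n /\ n %% period C D k < window C k.
    have [eqv|/eqP/periodize_neq[k [lek ltk]]] :=
      eqVneq (periodize C D (planted C D u) n) (planted C D u n).
      by apply: (planted_neq C D u); rewrite -eqv; apply/eqP.
    by exists k; split=> //; rewrite (leq_trans ltk) // leq_pmull.
  (* As [k < period C D k <= n < N], the levels below [N] suffice. *)
  have ltkN : k < N by rewrite (leq_trans (ltn_period C D k)) // (leq_trans lek) // ltnW.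
  by rewrite (bigD1 (Ordinal ltkN)) //= lek ltk.
rewrite exchange_big /=; apply: leq_sum => k _.
exact/sum_ge_modn_lt/period_gt0.
Qed.

(** Offsets in a planted word that no copying at levels up to [k] touches. The offset alone decides
    this, because the word starts at a multiple of every [period C D j] with [j <= k]. *)
Definition free_positions (C D k : nat) : {set 'I_(window C k)} :=
  [set i : 'I_(window C k) | [forall j : 'I_k.+1, 2 ^ j <= i %% period C D j]].

(** Every word is planted and its free letters survive, so the restrictions of the blocks to the
    free positions run through all functions there. *)
Lemma block_count_periodize (C D : nat) (u : nat -> sgn3) (k : nat) :
  3 ^ #|free_positions C D k| <=
    block_count (periodize C D (planted C D u)) (window C k).
Proof.
set t := periodize C D (planted C D u).
set L := window C k; set F := free_positions C D k; rewrite /block_count.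
set B := [pred b : L.-tuple sgn3 | _].
pose restr (b : L.-tuple sgn3) := [ffun i => if i \in F then tnth b i else Zero].
rewrite -card_sgn3 -(card_pffun_on Zero F {: sgn3}).
apply: leq_trans (leq_image_card restr B); apply: subset_leq_card.
apply/fintype.subsetP => f /pffun_onP[/fintype.subsetP suppf _].
have [j ltj wj] := word_surj L [tuple f i | i < L].
pose b := [tuple t (j.+1 * period C D k + i) | i < L].
apply/fintype.imageP; exists b.
  rewrite inE; exists (j.+1 * period C D k) => i.
  by rewrite tnth_mktuple.
apply/ffunP => i; rewrite ffunE; case: ifPn => [iF|]; last first.
  by apply: contraNeq => /(suppf i).
have [lt_i mod_i plant_i] := planted_word C D u k i j (ltn_ord i) ltj.
(* The index lies below [period C D k.+1], so only levels up to [k] could change the letter. *)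
rewrite tnth_mktuple /t (@periodize_id _ _ _ _ _ k.+1) //.
  by rewrite plant_i wj -tnth_nth tnth_mktuple.
move=> l ltl; rewrite -(modn_dvdm _ (dvdn_period C D l k ltl)) mod_i.
by move: iF; rewrite inE => /forallP/(_ (Ordinal ltl)).
Qed.

(** Union bound over the levels: the full periods are handled by [sum_div_period], the incomplete
    ones add the sum of the [2 ^ j], which is below [2 ^ k.+1]. *)
Lemma card_free_positions (C D k : nat) :
  D.+1 * window C k <=
    D.+1 * #|free_positions C D k| + window C k + D.+1 * 2 ^ k.+1.
Proof.
set L := window C k; set F := free_positions C D k.
have : #|~: F| <= \sum_(j < k.+1) L %/ period C D j * window C j + 2 ^ k.+1.
  apply: (@leq_trans (\sum_(j < k.+1) (L %/ period C D j).+1 * 2 ^ j)).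
    apply: (@leq_trans (\sum_(i < L) \sum_(j < k.+1) (i %% period C D j < 2 ^ j))).
      rewrite -sum1_card big_mkcond; apply: leq_sum => i _; case: ifP => //.
      rewrite !inE => /forallPn[j]; rewrite -ltnNge => ltj.
      by rewrite (bigD1 j) //= ltj.
    rewrite exchange_big /=; apply: leq_sum => j _.
    exact/sum_modn_lt/period_gt0.
  have -> : 2 ^ k.+1 = (\sum_(j < k.+1) 2 ^ j).+1.
    by have := predn_exp 2 k.+1; rewrite mul1n => <-; rewrite prednK // expn_gt0.
  rewrite addnS leqW // -big_split /=; apply: leq_sum => j _.
  by rewrite mulSnr leq_add2r leq_mul // leq_pmull.
have := sum_div_period C D L k.+1; have := cardsC F; rewrite card_ord.
move: (\sum_(_ < _) _) (2 ^ _) #|F| #|~: F| => x y f g sumL leL leg.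
have -> : D.+1 * L = D.+1 * f + D.+1 * g by rewrite -mulnDr sumL.
rewrite -addnA leq_add2l (leq_trans (leq_mul (leqnn D.+1) leg)) //.
by rewrite mulnDr leq_add2r.
Qed.

(** * Blocks and Sturmian sequences *)

Definition block {A : Type} (w : nat -> A) (n i : nat) : n.-tuple A :=
  [tuple w (i + j) | j < n].

Definition blocks {A : finType} (w : nat -> A) (n : nat) : {set n.-tuple A} :=
  [set b | `[< exists i : nat, b = block w n i >]].

Lemma mem_blocks {A : finType} (w : nat -> A) (n i : nat) :
  block w n i \in blocks w n.
Proof. by rewrite inE; apply/asboolP; exists i. Qed.

Lemma block_countE {A : finType} (w : nat -> A) (n : nat) :
  block_count w n = #|blocks w n|.
Proof.
apply: eq_card => b; rewrite !inE; apply: asbool_equiv_eq; split=> -[i hi]; exists i.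
  by apply: eq_from_tnth => j; rewrite tnth_mktuple hi.
by move=> j; rewrite hi tnth_mktuple.
Qed.

(** Without ones from [P] on, all blocks starting there are zero, which leaves at most [P.+1] blocks
    of length [P.+1] instead of [P.+2]. *)
Lemma sturmian_ones (w : nat -> bool) (P : nat) :
  sturmian w -> exists2 i, P <= i & w i.
Proof.
move=> sw; apply: contrapT => noone.
have w0 i : P <= i -> w i = false.
  by move=> lePi; apply/negP => wi; apply: noone; exists i.
have : #|blocks w P.+1| <= P.+1.
  rewrite -[X in _ <= X]card_ord -cardsT.
  apply: leq_trans (leq_imset_card (fun k : 'I_P.+1 => block w P.+1 k) _).
  apply: subset_leq_card; apply/fintype.subsetP => b; rewrite inE => /asboolP[i ->].
  have [ltiP|leiP] := ltnP i P.+1.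
    by apply/imsetP; exists (Ordinal ltiP).
  apply/imsetP; exists ord_max => //; apply: eq_from_tnth => j.
  by rewrite !tnth_mktuple !w0 //= ?leq_addr // (leq_trans (ltnW leiP)) ?leq_addr.
by rewrite -block_countE sw // ltnn.
Qed.

(* If there were zero runs of every length, the n.+1 possible positions of the
   first one in a block of length n would all occur, hence determine the block.
   Two occurrences of a one would then have the same future. *)
Lemma sturmian_bounded_gaps (w : nat -> bool) : sturmian w ->
  exists g, forall i, exists2 j, j < g & w (i + j).
Proof.
move=> sw; apply: contrapT => nogap.
have run g : exists s, forall j, j < g -> w (s + j) = false.
  apply: contrapT => norun; apply: nogap; exists g => i.
  apply: contrapT => noj; apply: norun; exists i => j ltj.
  by apply/negP => wij; apply: noj; exists j.
have first_inj n : {in blocks w n &, injective (fun b : n.-tuple bool => find id b)}.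
  case: n => [|n] ; first by move=> b c; rewrite (tuple0 b) (tuple0 c).
  pose first (b : n.+1.-tuple bool) : 'I_n.+2 := inord (find id b).
  have first_val b : first b = find id b :> nat.
    by rewrite inordK // ltnS -[X in _ <= X](size_tuple b) find_size.
  suff inj : {in blocks w n.+1 &, injective first}.
    by move=> b c bB cB eqbc; apply: inj => //; apply: val_inj; rewrite /= !first_val.
  (* There are as many blocks as possible values, so it suffices that every [j] is attained;
     [j = n.+1] stands for the zero block. *)
  apply/imset_injP; rewrite eqn_leq leq_imset_card /= -block_countE sw //.
  rewrite -[X in X <= _]card_ord -cardsT; apply: subset_leq_card.
  apply/fintype.subsetP => j _; have [s s0] := run n.+1.
  have [e lese we] := sturmian_ones w s sw.
  have ex_e : exists e, (s <= e) && w e by exists e; rewrite lese.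
  case: (ex_minnP ex_e) => {e ex_e lese we} e /andP[lese we] mine.
  have lene : s + n.+1 <= e.
    rewrite leqNgt; apply/negP => lte; move: we.
    by rewrite -(subnKC lese) s0 // ltn_subLR.
  have lejn : j <= n.+1 by rewrite -ltnS.
  have leje : j <= e by lia.
  (* At least [n.+1] zeros precede the one at [e], so starting [j] letters earlier puts the first
     one at position [j]. *)
  apply/imsetP; exists (block w n.+1 (e - j)); first exact: mem_blocks.
  apply: val_inj; rewrite /= first_val.
  have sz := size_tuple (block w n.+1 (e - j)).
  have nth_block l : l < n.+1 -> nth false (block w n.+1 (e - j)) l = w (e - j + l).
    by move=> ltl; rewrite -(tnth_nth _ _ (Ordinal ltl)) tnth_mktuple.
  set b := block w n.+1 (e - j) in sz nth_block *.
  have before l : l < j -> nth false b l = false.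
    move=> ltl; rewrite nth_block; last by lia.
    apply/negP => wl; have := mine (e - j + l); rewrite wl andbT.
    lia.
  apply/eqP; rewrite eqn_leq; apply/andP; split.
    rewrite leqNgt; apply/negP => ltf; have := before _ ltf.
    have hasb : has id b by rewrite has_find sz (leq_trans ltf).
    by rewrite (nth_find false hasb).
  rewrite leqNgt; apply/negP => ltf; have := before_find false ltf.
  have jn : j < n.+1 by apply: leq_trans ltf _; rewrite -[X in _ <= X]sz find_size.
  by rewrite nth_block // subnK // we.
(* Blocks that start with a one share the value 0 of [find], so those of equal length coincide. *)
have future i i' k : w i -> w i' -> w (i + k) = w (i' + k).
  move=> wi wi'.
  have find0 l : w l -> find id (block w k.+1 l) = 0.
    move=> wl; have := before_find false (s := block w k.+1 l) (a := id) (i := 0).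
    case: (find _ _) => // m /(_ isT).
    by rewrite -(tnth_nth _ _ ord0) tnth_mktuple addn0 wl.
  have := first_inj k.+1 _ _ (mem_blocks w k.+1 i) (mem_blocks w k.+1 i').
  rewrite !find0 // => /(_ erefl)/(congr1 (fun b => tnth b ord_max)).
  by rewrite !tnth_mktuple.
have [i _ wi] := sturmian_ones w 0 sw.
have [i' lti wi'] := sturmian_ones w i.+1 sw.
pose p := i' - i; have p0 : 0 < p by rewrite subn_gt0.
have wper m : w (i + m * p).
  elim: m => [|m IHm]; first by rewrite addn0.
  have -> : i + m.+1 * p = (i + m * p) + p by rewrite mulSnr addnA.
  by rewrite (future _ i) // /p subnKC // ltnW.
(* A zero run this long contains [i] if it starts before [i], and otherwise some [i + m * p], where
   [wper] gives a one. *)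
have [s s0] := run (i + p).+1.
have [ltsi|leis] := ltnP s i.
  by move: wi; rewrite -{1}(subnKC (ltnW ltsi)) s0 //; lia.
have := wper ((s - i) %/ p).+1.
have := ltn_ceil (s - i) p0; have := leq_trunc_div (s - i) p.
rewrite mulSn; move: (_ %/ _ * p) => q leq ltq wq.
have les : s <= i + (p + q) by lia.
by move: wq; rewrite -(subnKC les) s0 //; lia.
Qed.

Lemma sum_ones_ge (w : nat -> bool) (g m i : nat) :
    (forall i, exists2 j, j < g & w (i + j)) ->
  m <= \sum_(j < g * m) w (i + j).
Proof.
move=> gap; rewrite -(big_mkord xpredT (fun j => w (i + j) : nat)).
elim: m => [|m IHm] //.
rewrite (big_cat_nat (n := g * m)) ?leq_mul //= -[X in X <= _]addn1 leq_add //.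
have [j ltj wj] := gap (i + g * m).
have mem_j : g * m + j \in index_iota (g * m) (g * m.+1).
  by rewrite mem_index_iota leq_addr mulnS addnC ltn_add2r.
by rewrite (bigD1_seq _ mem_j) ?iota_uniq //= addnA wj leq_addr.
Qed.

Lemma sum_shift_le (f : nat -> bool) (N m : nat) :
  \sum_(i < N) f (i + m) <= \sum_(i < N) f i + m.
Proof.
rewrite -(big_mkord xpredT (fun i => f (i + m) : nat)).
rewrite -(big_mkord xpredT (fun i => f i : nat)).
have -> : \sum_(0 <= i < N) f (i + m) = \sum_(m <= i < N + m) f i.
  by rewrite -{2}[m]add0n big_addn addnK.
apply: (@leq_trans (\sum_(0 <= i < N + m) f i)).
  by rewrite [X in _ <= X](big_cat_nat (n := m)) ?leq_addl //= leq_addl.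
rewrite (big_cat_nat (n := N)) ?leq_addr //= leq_add2l.
apply: (@leq_trans (\sum_(N <= i < N + m) 1)); first by apply: leq_sum => i _; case: f.
by rewrite sum_nat_const_nat muln1 addKn.
Qed.

Definition vanishes_on {L : nat} (b : L.-tuple bool) (u : nat -> sgn3) : bool :=
  [forall j : 'I_L, tnth b j ==> (u j == Zero)].

(** Either the window of [u] at [n.+1] vanishes on the block of [eta] there, or it contains a
    nonzero position of the product. Each position lies in at most [L] windows, and windows
    overshoot [N] by at most [L]. *)
Lemma sum_nonzero_ge (eta : nat -> bool) (u : nat -> sgn3) (L N : nat) :
  N <= L * (\sum_(n < N) (eta n && (u n != Zero)) + L) +
       \sum_(b in blocks eta L)
         \sum_(n < N) vanishes_on b (iter n.+1 (@seq_shift sgn3) u).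
Proof.
have iterE n j : iter n (@seq_shift sgn3) u j = u (n + j).
  elim: n j => //= n IHn j; by rewrite /seq_shift /= IHn addnS.
pose f n := eta n && (u n != Zero).
apply: (@leq_trans (\sum_(n < N) (\sum_(j < L) f (n + j.+1) +
   \sum_(b in blocks eta L) vanishes_on b (iter n.+1 (@seq_shift sgn3) u)))).
  rewrite -[X in X <= _]card_ord -sum1_card; apply: leq_sum => n _.
  have [vn|/forallPn[j]] :=
    boolP (vanishes_on (block eta L n.+1) (iter n.+1 (@seq_shift sgn3) u)).
    by rewrite addnC (bigD1 (block eta L n.+1)) ?mem_blocks //= vn.
  rewrite negb_imply tnth_mktuple iterE -[eta _ && _]/(f _) => fj.
  by rewrite (bigD1 j) //= addnS -addSn fj.
rewrite big_split leq_add //=; last by rewrite exchange_big.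
rewrite exchange_big /= -[X in _ <= X * _]card_ord -sum_nat_const.
apply: leq_sum => j _; apply: leq_trans (sum_shift_le f N j.+1) _.
by rewrite leq_add2l.
Qed.

End Combinatorics.

(** * Generic points of Bernoulli measures *)

(** Clopenness makes the indicator continuous, hence a test function for weak convergence. *)
Lemma clopen_vanishes_on (L : nat) (b : L.-tuple bool) :
  clopen [set w : seq3 | vanishes_on b w].
Proof.
have -> : [set w : seq3 | vanishes_on b w] =
    [set w : seq3 | all (fun j : 'I_L => tnth b j ==> (w j == Zero)) (enum 'I_L)].
  apply/seteqP; split=> w /=; first by move=> /forallP h; apply/allP => j _; exact: h.
  by move=> /allP h; apply/forallP => j; rewrite h ?mem_enum.
elim: (enum 'I_L) => [|j s IHs] /=.
  by have := @clopenT seq3; congr clopen; apply/seteqP; split.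
have -> : [set w : seq3 | (tnth b j ==> (w j == Zero)) &&
      all (fun j : 'I_L => tnth b j ==> (w j == Zero)) s] =
    [set w : seq3 | tnth b j ==> (w j == Zero)] `&`
    [set w : seq3 | all (fun j : 'I_L => tnth b j ==> (w j == Zero)) s].
  by apply/seteqP; split=> w /=; [move/andP | move=> ?; apply/andP].
apply: clopenI => //.
apply: (@preimage_clopen seq3 sgn3 (fun w => w (j : nat))
  [set s | tnth b j ==> (s == Zero)]); last exact: (@proj_continuous nat (fun=> sgn3) j).
by split; [exact: discrete_open|exact: discrete_closed].
Qed.

Lemma continuous_indic (R : realType) (T : topologicalType) (A : set T) :
  clopen A -> continuous (\1_A : T -> R).
Proof.
move=> [oA cA]; apply/continuousP => U oU; rewrite preimage_indic.
case: ifP => _; case: ifP => _ //; first exact: openT.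
- by rewrite openC.
- exact: open0.
Qed.

Lemma measurable_open_seq3 (A : set seq3) :
  open A -> measurable (A : set borel_seq3).
Proof. by move=> oA; apply: sub_sigma_algebra. Qed.

Lemma empiricalE (R : realType) (u : nat -> sgn3) (N : nat) (A : set borel_seq3) :
  empirical R u N A =
    (N%:R^-1 * \sum_(n < N) \1_A (iter n.+1 (@seq_shift sgn3) u : borel_seq3))%:E.
Proof.
rewrite /empirical /mscale /= /msum /= EFinM; congr (_ * _)%E.
by rewrite -sumEFin; apply: eq_bigr => n _; by [].
Qed.

Lemma generic_clopen (R : realType) (u : nat -> sgn3) (B : probability borel_seq3 R)
    (A : set seq3) : generic u B -> clopen A ->
  N%:R^-1 * \sum_(n < N) \1_A (iter n.+1 (@seq_shift sgn3) u : seq3) @[N --> \oo]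
    --> fine (B A).
Proof.
move=> gen cA; have mA : measurable (A : set borel_seq3).
  by apply: measurable_open_seq3; case: cA.
have bA : bounded_fun (\1_A : seq3 -> R).
  exists 1; split=> // x lt1x y _ /=; rewrite indicE.
  by case: (_ \in _); rewrite /= ?normr0 ?normr1 ltW // (lt_trans ltr01).
have := gen (\1_A) (continuous_indic R _ _ cA) bA.
rewrite integral_indic // setIT.
under eq_fun do rewrite integral_indic // setIT empiricalE.
move=> cvgB.
have BA : (fine (B A))%:E = B A by rewrite fineK // fin_num_measure.
pose f N := (N%:R^-1 * \sum_(n < N) \1_A (iter n.+1 (@seq_shift sgn3) u : seq3) : R)%:E.
have cvgB' : f N @[N --> \oo] --> (fine (B A))%:E by rewrite BA.
exact: (fine_cvg cvgB').
Qed.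

Lemma bernoulli_vanishes_on (R : realType) (B : probability borel_seq3 R)
    (P : probability sgn3 R) (L : nat) (b : L.-tuple bool) :
    (forall (n : nat) (A : 'I_n -> set sgn3),
      B [set w : nat -> sgn3 | forall i : 'I_n, A i (w i)] = (\prod_(i < n) P (A i))%E) ->
  fine (B [set w | vanishes_on b w]) =
    fine (P [set Zero]) ^+ (\sum_(j < L) tnth b j)%N.
Proof.
move=> BP; pose A j : set sgn3 := if tnth b j then [set Zero] else [set: sgn3].
have -> : [set w | vanishes_on b w] = [set w : nat -> sgn3 | forall j, A j (w j)].
  apply/seteqP; split=> w /=; rewrite /A.
    move=> /forallP h j; have := h j; case: ifP => // _ /=.
    by move/eqP.
  move=> h; apply/forallP => j; have := h j; case: ifP => //= _ ->.
  by rewrite eqxx.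
rewrite BP.
have -> : (\prod_(i < L) P (A i) = (\prod_(i < L) fine (P [set Zero]) ^+ (tnth b i : nat))%:E)%E.
  rewrite -prodEFin; apply: eq_bigr => i _; rewrite /A; case: (tnth b i).
    by rewrite expr1 fineK // fin_num_measure.
  by rewrite expr0 probability_setT.
by rewrite /= expr_sum.
Qed.

(** Otherwise the cylinders of [n] initial zeros all have measure 1, and by continuity from above so
    does their intersection, the zero sequence. *)
Lemma bernoulli_Zero_lt1 (R : realType) (B : probability borel_seq3 R)
    (P : probability sgn3 R) :
    (forall (n : nat) (A : 'I_n -> set sgn3),
      B [set w : nat -> sgn3 | forall i : 'I_n, A i (w i)] = (\prod_(i < n) P (A i))%E) ->
    B [set (fun=> Zero)] <> 1%E ->
  fine (P [set Zero]) < 1.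
Proof.
move=> BP B0.
have P0 : P [set Zero] \is a fin_num by rewrite fin_num_measure.
have : (P [set Zero] <= 1)%E by apply: probability_le1.
rewrite -{1}(fineK P0) lee_fin le_eqVlt => /predU1P[|] // P1; exfalso; apply: B0.
pose F n : set seq3 := [set w | vanishes_on [tuple true | j < n] w].
have mF n : measurable (F n : set borel_seq3).
  by apply: measurable_open_seq3; case: (clopen_vanishes_on _ [tuple true | j < n]).
have BF n : B (F n) = 1%E.
  have -> : B (F n) = (fine (B (F n)))%:E.
    by rewrite fineK // fin_num_measure.
  by rewrite (bernoulli_vanishes_on _ _ P) // P1 /= expr1n.
have capF : \bigcap_n F n = [set (fun=> Zero)].
  apply/seteqP; split=> [w /= Fw|w /= -> n _]; last first.
    by apply/forallP => j; rewrite eqxx implybT.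
  apply/funext => n; have /forallP/(_ ord_max) := Fw n.+1 I.
  by rewrite tnth_mktuple => /eqP.
rewrite -capF.
have limF : (B \o F) n @[n --> \oo] --> B (\bigcap_n F n).
  apply: nonincreasing_cvg_mu => //; first by rewrite -[X in (X < _)%E]/(B (F 0)) BF ltry.
    exact: bigcapT_measurable.
  apply/nonincreasing_seqP => n; apply/subsetPset => w /forallP h; apply/forallP => j.
  by have := h (widen_ord (leqnSn n) j); rewrite !tnth_mktuple.
have BF1 : B \o F = cst 1%E by apply/funext => n; exact: BF.
rewrite BF1 in limF.
exact/esym/(cvg_unique _ (cvg_cst _) limF).
Qed.

(** * Topological entropy *)

(** Fekete's lemma: the limit is the infimum over positive [n]. *)
Lemma is_cvg_subadditive_div (R : realType) (a : nat -> R) :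
    (forall n, 0 <= a n) -> (forall m n, a (m + n)%N <= a m + a n) ->
  cvgn (fun n => a n / n%:R).
Proof.
move=> a0 aD; pose S : set R := [set a n / n%:R | n in [set n | (0 < n)%N]].
have S_lb : lbound S 0 by move=> _ [n _ <-]; rewrite divr_ge0.
have S_inf : has_inf S by split; [exists (a 1%N / 1%:R), 1%N | exists 0].
have aM m q : a (q * m)%N <= q%:R * a m + a 0%N.
  elim: q => [|q IHq]; first by rewrite mul0n mul0r add0r.
  rewrite mulSn (le_trans (aD _ _)) // -natr1 mulrDl mul1r.
  by rewrite addrC addrAC lerD2r.
apply/cvg_ex; exists (inf S); apply/cvgrPdist_le => e e0.
have e20 : 0 < e / 2 by rewrite divr_gt0.
have [_ [m m0 <-] ltm] := inf_adherent e20 S_inf.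
(* Bounds every remainder [a (n %% m)] together with the term [a 0] from [aM]. *)
pose M := a 0%N + \sum_(r < m) a r.
near=> n.
have n0 : (0 < n)%N by near: n; exists 1%N.
have n0R : 0 < n%:R :> R by rewrite ltr0n.
have leinf : inf S <= a n / n%:R by apply: ge_inf; [exists 0 | exists n].
rewrite distrC ger0_norm ?subr_ge0 // lerBlDr.
have leM : M <= e / 2 * n%:R.
  rewrite -ler_pdivrMl // mulrC; near: n.
  exact: nbhs_infty_ger.
have : a n <= (n %/ m)%:R * a m + M.
  rewrite {1}(divn_eq n m) (le_trans (aD _ _)) // /M addrA lerD //.
  by rewrite (bigD1 (Ordinal (ltn_pmod n m0))) //= lerDl sumr_ge0.
have leq : (n %/ m)%:R * a m <= a m / m%:R * n%:R.
  have m0R : 0 < m%:R :> R by rewrite ltr0n.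
  rewrite mulrAC [a m * _]mulrC mulrAC ler_wpM2r // ler_pdivlMr // -natrM ler_nat.
  exact: leq_trunc_div.
move=> lean; rewrite ler_pdivrMr // (le_trans lean) //.
apply: le_trans (lerD leq leM) _; rewrite -mulrDl ler_pM2r //.
by move: ltm; lra.
Unshelve. all: by end_near. Qed.

Lemma block_count_gt0 (A : finType) (w : nat -> A) (n : nat) :
  (0 < block_count w n)%N.
Proof. by rewrite block_countE; apply/card_gt0P; exists (block w n 0); apply: mem_blocks. Qed.

Lemma block_count_add (A : finType) (w : nat -> A) (m n : nat) :
  (block_count w (m + n) <= block_count w m * block_count w n)%N.
Proof.
rewrite !block_countE -cardsX.
apply: leq_trans (leq_imset_card (fun p => cat_tuple p.1 p.2) _).
apply: subset_leq_card; apply/fintype.subsetP => b; rewrite inE => /asboolP[i ->].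
apply/imsetP; exists (block w m i, block w n (i + m)%N); first by rewrite inE /= !mem_blocks.
apply: eq_from_tnth => j; rewrite tnth_mktuple; case: (split_ordP j) => k ->.
  by rewrite tnth_lshift tnth_mktuple.
by rewrite tnth_rshift tnth_mktuple /= addnA.
Qed.

Lemma block_count_le (A : finType) (w : nat -> A) (n : nat) :
  (block_count w n <= #|A| ^ n)%N.
Proof. by rewrite -card_tuple max_card. Qed.

Lemma log2_ge0 (R : realType) (n : nat) : (0 < n)%N -> 0 <= log2 (n%:R : R).
Proof. by move=> n0; rewrite divr_ge0 ?ln_ge0 ?ler1n. Qed.

Lemma ler_log2_nat (R : realType) (m n : nat) :
  (0 < m)%N -> (m <= n)%N -> log2 (m%:R : R) <= log2 (n%:R : R).
Proof.
move=> m0 lemn; rewrite ler_wpM2r ?invr_ge0 ?ln_ge0 ?ler1n //.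
by rewrite ler_ln ?posrE ?ltr0n ?ler_nat // (leq_trans m0).
Qed.

Lemma log2M (R : realType) (m n : nat) : (0 < m)%N -> (0 < n)%N ->
  log2 ((m * n)%:R : R) = log2 (m%:R : R) + log2 (n%:R : R).
Proof. by move=> m0 n0; rewrite /log2 natrM lnM ?posrE ?ltr0n // mulrDl. Qed.

Lemma log2X (R : realType) (m n : nat) : (0 < m)%N ->
  log2 ((m ^ n)%:R : R) = n%:R * log2 (m%:R : R).
Proof. by move=> m0; rewrite /log2 natrX lnXn ?ltr0n // mulr_natl mulrnAl. Qed.

Lemma is_cvg_htop (R : realType) (A : finType) (w : nat -> A) :
  cvgn (fun n : nat => log2 ((block_count w n)%:R : R) / n%:R).
Proof.
apply: is_cvg_subadditive_div => [n|m n]; first by rewrite log2_ge0 ?block_count_gt0.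
by rewrite -log2M ?block_count_gt0 // ler_log2_nat ?block_count_gt0 ?block_count_add.
Qed.

Lemma htop_ge0 (R : realType) (A : finType) (w : nat -> A) : 0 <= htop R w.
Proof.
apply: limr_ge; first exact: is_cvg_htop.
by apply: nearW => n; rewrite divr_ge0 ?log2_ge0 ?block_count_gt0.
Qed.

Lemma htop_le (R : realType) (A : finType) (w : nat -> A) :
  htop R w <= log2 #|A|%:R.
Proof.
apply: limr_le; first exact: is_cvg_htop.
near=> n; have n0 : (0 < n)%N by near: n; exists 1%N.
rewrite ler_pdivrMr ?ltr0n // mulrC -log2X; last by apply/card_gt0P; exists (w 0%N).
by rewrite ler_log2_nat ?block_count_gt0 ?block_count_le.
Unshelve. all: by end_near. Qed.

(** As the limit exists, arbitrarily large lengths suffice; the lengths [window C N] will be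
    used. *)
Lemma htop_ge (R : realType) (A : finType) (w : nat -> A) (c : R) :
    (forall N, exists2 n, (N <= n)%N & c <= log2 (block_count w n)%:R / n%:R) ->
  c <= htop R w.
Proof.
move=> hc; rewrite leNgt; apply/negP => ltc.
have /cvgr_lt/(_ _ ltc)[N _ hN] := is_cvg_htop R A w.
have [n leNn lec] := hc N.
by have := hN n leNn; rewrite /= ltNge lec.
Qed.

Lemma htop_periodize (R : realType) (C D : nat) (u : nat -> sgn3) :
  (1 - D.+1%:R^-1 - 2 / C.+1%:R) * log2 3%:R <=
    htop R (periodize C D (planted C D u)).
Proof.
apply: htop_ge => N; exists (window C N).
  by rewrite (leq_trans (ltnW (ltn_expl N (ltnSn 1)))) // leq_pmull.
set t := periodize _ _ _; set L := window C N.
have L0 : 0 < L%:R :> R by rewrite ltr0n muln_gt0 expn_gt0.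
rewrite ler_pdivlMr //.
apply: le_trans (_ : log2 (3 ^ #|free_positions C D N|)%:R <= _); last first.
  by rewrite ler_log2_nat ?expn_gt0 ?block_count_periodize.
rewrite log2X // mulrAC ler_wpM2r ?log2_ge0 //.
set f := #|_|; have le_free : D.+1%:R * L%:R <=
    D.+1%:R * f%:R + L%:R + D.+1%:R * (2 ^ N.+1)%:R :> R.
  by rewrite -!natrM -!natrD ler_nat card_free_positions.
have c0 : 0 < C.+1%:R :> R by rewrite ltr0n.
have d0 : 0 < D.+1%:R :> R by rewrite ltr0n.
have powE : (2 ^ N.+1)%:R = 2 * L%:R / C.+1%:R :> R.
  by rewrite /L /window natrM expnS natrM [C.+1%:R * _]mulrC mulrA mulfK ?gt_eqF.
rewrite powE in le_free; rewrite -(ler_pM2l d0).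
have -> : D.+1%:R * ((1 - D.+1%:R^-1 - 2 / C.+1%:R) * L%:R) =
    D.+1%:R * L%:R - L%:R - D.+1%:R * (2 * L%:R / C.+1%:R) :> R.
  move: c0 d0 (L%:R); move: (C.+1%:R) (D.+1%:R) => c d c0 d0 l.
  by field; rewrite !gt_eqF.
by rewrite 2!lerBlDr addrAC.
Qed.

(** * Correlation *)

(** Write [p = s * s]: one factor [s ^ m] keeps the affine term bounded by [K], the other tends to
    0. *)
Lemma affine_geometric_small (R : realType) (g : nat) (p e : R) :
    0 <= p < 1 -> 0 < e ->
  exists2 m, (0 < m)%N & (g * m).+1%:R * p ^+ m < e.
Proof.
move=> /andP[p0 p1] e0; pose s := Num.sqrt p.
have s0 : 0 <= s by apply: sqrtr_ge0.
have s1 : s < 1 by rewrite -sqrtr1 ltr_sqrt.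
have d0 : 0 < 1 - s by rewrite subr_gt0.
have lin m : m%:R * s ^+ m * (1 - s) <= 1.
  (* The right side is [1 - s] times a sum of [m] powers of [s], each at least [s ^+ m]. *)
  suff : m%:R * s ^+ m * (1 - s) <= 1 - s ^+ m.
    by move=> /le_trans; apply; rewrite lerBlDr lerDl exprn_ge0.
  elim: m => [|m IHm]; first by rewrite !mul0r expr0 subrr.
  have x1 : s * s ^+ m <= 1 by rewrite -exprS exprn_ile1 // ltW.
  have h1 := ler_wpM2l s0 IHm.
  have h2 : 0 <= (1 - s) * (1 - s * s ^+ m) by rewrite mulr_ge0 ?subr_ge0 // ltW.
  rewrite exprS -natr1; move: h1 h2; move: (s ^+ m) (m%:R) => x y; nra.
pose K := g%:R / (1 - s) + 1.
have K0 : 0 < K by rewrite ltr_wpDl // divr_ge0 // ltW.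
have : s ^+ m @[m --> \oo] --> 0 by apply: cvg_expr; rewrite ger0_norm.
move=> /cvgr_lt/(_ (e / K)); rewrite divr_gt0 // => /(_ isT)[N _ hN].
exists N.+1 => //; have := hN N.+1 (leqnSn N); rewrite /= ltr_pdivlMr //.
apply: le_lt_trans; have -> : p = s * s by rewrite -expr2 sqr_sqrtr.
set m := N.+1; have sm0 : 0 <= s ^+ m by rewrite exprn_ge0.
rewrite exprMn mulrA [leRHS]mulrC ler_wpM2r //.
rewrite -natr1 natrM mulrDl mul1r /K lerD //; last by rewrite exprn_ile1 // ltW.
by rewrite -mulrA ler_wpM2l // -[_^-1]mul1r ler_pdivlMr.
Qed.

Lemma nonzero_lower_density (R : realType) (eta : nat -> bool) (u : nat -> sgn3)
    (B : probability borel_seq3 R) :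
    sturmian eta -> bernoulli B -> B [set (fun=> Zero)] <> 1%E -> generic u B ->
  exists2 c : R, 0 < c &
    \forall N \near \oo, c * N%:R <= (\sum_(n < N) (eta n && (u n != Zero)))%N%:R.
Proof.
move=> eta_sturm [P BP] B0 gen.
have [g gap] := sturmian_bounded_gaps eta eta_sturm.
have p1 := bernoulli_Zero_lt1 _ B P BP B0.
set p := fine _ in p1; have p0 : 0 <= p by rewrite fine_ge0.
have half0 : 0 < 2^-1 :> R by rewrite invr_gt0.
have p01 : 0 <= p < 1 by rewrite p0.
have [m m0 small] := affine_geometric_small R g p _ p01 half0.
have g0 : (0 < g)%N by have [j + _] := gap 0%N; case: g {gap small}.
set L := (g * m)%N in small; have L0 : (0 < L)%N by rewrite muln_gt0 g0.
pose V (b : L.-tuple bool) N : nat :=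
  (\sum_(n < N) vanishes_on b (iter n.+1 (@seq_shift sgn3) u))%N.
have cvgV b : N%:R^-1 * (V b N)%:R @[N --> \oo] --> p ^+ (\sum_(j < L) tnth b j)%N.
  rewrite -(bernoulli_vanishes_on _ B P L b BP).
  have -> : (fun N => N%:R^-1 * (V b N)%:R) = (fun N => N%:R^-1 * \sum_(n < N)
      \1_[set w : seq3 | vanishes_on b w] (iter n.+1 (@seq_shift sgn3) u : seq3)) :> (nat -> R).
    apply/funext => N; congr (_ * _); rewrite /V natr_sum.
    by apply: eq_bigr => n _; rewrite indicE mem_setE.
  exact: generic_clopen gen (clopen_vanishes_on L b).
have cvg_sum : \sum_(b in blocks eta L) N%:R^-1 * (V b N)%:R @[N --> \oo] -->
    \sum_(b in blocks eta L) p ^+ (\sum_(j < L) tnth b j)%N.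
  by apply: cvg_big => [|b _]; [exact: add_continuous | exact: cvgV].
(* There are [L.+1] blocks, each with at least [m] ones. *)
have lim_small : \sum_(b in blocks eta L) p ^+ (\sum_(j < L) tnth b j)%N < 2^-1.
  apply: le_lt_trans small.
  apply: (@le_trans _ _ (\sum_(b in blocks eta L) p ^+ m)).
    apply: ler_sum => b; rewrite inE => /asboolP[i ->].
    apply: ler_wiXn2l => //; first exact: ltW.
    under eq_bigr do rewrite tnth_mktuple.
    exact: sum_ones_ge.
  by rewrite sumr_const -block_countE eta_sturm // mulr_natl.
have LR0 : 0 < L%:R :> R by rewrite ltr0n.
have ev_small := cvgr_lt _ cvg_sum _ lim_small.
(* Vanishing windows account for at most [N / 2] and the boundary term [L * L] for at most [N / 4],
   which leaves [N / 4] for [L] times the count. *)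
exists (4 * L%:R)^-1; first by rewrite invr_gt0 mulr_gt0.
near=> N.
have N0 : 0 < N%:R :> R by rewrite ltr0n; near: N; exists 1%N.
have : \sum_(b in blocks eta L) N%:R^-1 * (V b N)%:R < 2^-1 :> R.
  by near: N; exact: ev_small.
rewrite -mulr_sumr mulrC ltr_pdivrMr // -natr_sum => ltV.
have := sum_nonzero_ge eta u L N; rewrite -(ler_nat R) natrD natrM natrD.
have : 4 * L%:R * L%:R <= N%:R :> R by near: N; exact: nbhs_infty_ger.
rewrite ler_pdivrMl ?mulr_gt0 //; move: ltV LR0; rewrite -/(V _ N).
move: (\sum_(_ < _) _)%:R (_%:R) (L%:R) (N%:R) => f v l n; nra.
Unshelve. all: by end_near. Qed.

Lemma limn_einf_gt0 (R : realType) (f : nat -> R) (c : R) :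
    0 < c -> (\forall n \near \oo, c <= f n) ->
  (0 < limn_einf (fun n => (f n)%:E))%E.
Proof.
move=> c0 [N _ hN]; apply: (@lt_le_trans _ _ c%:E); first by rewrite lte_fin.
rewrite limn_einf_lim; apply: lime_ge; first exact: is_cvg_einfs.
exists N => // n /= leNn; apply: le_ereal_inf_tmp => _ [k /= lenk <-].
by rewrite lee_fin hN //= (leq_trans leNn).
Qed.

(** Where [t] agrees with [u] the term is the square of a letter; elsewhere it is at least [-1], a
    loss of at most 2. *)
Lemma correlation_ge (R : realType) (eta : nat -> bool) (t u : nat -> sgn3) (N : nat) :
  (\sum_(n < N) (eta n && (u n != Zero)))%N%:R - 2 * (\sum_(n < N) (t n != u n))%N%:R <=
    \sum_(n < N) (sgn3_val (t n))%:~R * (sgn3_val (seq_mul eta u n))%:~R :> R.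
Proof.
rewrite !natr_sum mulr_sumr -sumrB; apply: ler_sum => n _.
have : (eta n && (u n != Zero))%:R - 2 * (t n != u n)%:R <=
    sgn3_val (t n) * sgn3_val (seq_mul eta u n).
  by rewrite /seq_mul; case: (eta n) (t n) (u n) => -[] [].
by rewrite -(ler_int R) rmorphB !rmorphM /= !rmorph_nat.
Qed.

Theorem corollary7p26 (R : realType)
    (eta : nat -> bool) (eta_sturmian : sturmian eta)
    (B : probability borel_seq3 R) (B_bernoulli : bernoulli B)
    (* B is not the point mass at the zero sequence *)
    (B_nonzero : B [set (fun=> Zero)] <> 1%E)
    (u : nat -> sgn3) (u_generic : generic u B)
    (eps : R) (eps_gt0 : 0 < eps) :
  exists t : nat -> sgn3,
    [/\ toeplitz t,
        correlates R t (seq_mul eta u) &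
        (1 - eps) * htop R (seq_mul eta u) <= htop R t].
Proof.
have [c c0 dens] :=
  nonzero_lower_density R eta u B eta_sturmian B_bernoulli B_nonzero u_generic.
have inv_small (x : R) : 0 < x -> exists n, n.+1%:R^-1 <= x.
  move=> x0; exists (Num.truncn x^-1).
  by rewrite -[leRHS]invrK lef_pV2 ?posrE ?invr_gt0 // ltW // truncnS_gt.
(* The bound [c / 4] keeps the correlation above [c - 2 * (c / 4) = c / 2]; [eps / 2] here and
   [eps / 4] for [C] make the entropy loss at most [eps]. *)
have [D leD] : exists D : nat, D.+1%:R^-1 <= Num.min (c / 4) (eps / 2).
  by apply: inv_small; rewrite lt_min !divr_gt0.
have [C leC] : exists C : nat, C.+1%:R^-1 <= eps / 4 by apply: inv_small; rewrite divr_gt0.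
move: leD; rewrite le_min => /andP[leDc leDe].
set z := seq_mul eta u; set t := periodize C D (planted C D u).
exists t; split; first exact: toeplitz_periodize.
  apply: (limn_einf_gt0 R _ (c / 2)); first by rewrite divr_gt0.
  near=> N; have N0 : 0 < N%:R :> R by rewrite ltr0n; near: N; exists 1%N.
  rewrite ler_pdivlMr //; apply: le_trans (correlation_ge R eta t u N).
  have : c * N%:R <= (\sum_(n < N) (eta n && (u n != Zero)))%N%:R by near: N.
  have : (\sum_(n < N) (t n != u n))%N%:R <= c / 4 * N%:R :> R.
    apply: le_trans (ler_wpM2r (ltW N0) leDc).
    by rewrite ler_pdivlMl // -natrM ler_nat count_periodize_neq.
  move: (\sum_(_ < _) _)%N%:R (\sum_(_ < _) _)%N%:R (N%:R) => x y n; lra.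
have log3 : 0 <= log2 3%:R :> R by rewrite log2_ge0.
(* Bounding the entropy of [z] by [log2 3] needs a nonnegative factor [1 - eps]; for [eps >= 1] the
   left side is at most 0. *)
have [eps1|eps1] := leP 1 eps.
  by rewrite (@le_trans _ _ 0) ?htop_ge0 // mulr_le0_ge0 ?htop_ge0 // subr_le0.
apply: le_trans (htop_periodize R C D u).
apply: (@le_trans _ _ ((1 - eps) * log2 3%:R)).
  rewrite ler_wpM2l ?subr_ge0 ?(ltW eps1) // (le_trans (htop_le R _ z)) //.
  by rewrite card_sgn3.
by rewrite ler_wpM2r //; move: leC leDe; move: (C.+1%:R^-1) (D.+1%:R^-1) => x y; lra.
Unshelve. all: by end_near. Qed.
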